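(* Let $$U=\left\{z=(\alpha,\beta,M)\in Z:\ |\alpha|<r,\ |\beta|<s,\ f_0(M-M^T)\cdot(\alpha-\beta)=0,\ \|M_0(z)\|_n<G(z)\right\}.$$ Then $K_{r,s}^\Lambda\subset\overline{U}$, where $\overline{U}$ is the closure of $U$ in $Z$.
   Context: Fix real numbers $r>0$, $s>0$ and $p\in\mathbb{R}$ with $|p|\le rs$ (in the source $p$ is the value at a point of a given pressure function). Let $Z:=\mathbb{R}^3\times\mathbb{R}^3\times\mathbb{R}^{3\times 3}$, with elements written $z=(\alpha,\beta,M)$. For $a,b\in\mathbb{R}^3$, $a\otimes b:=ab^T\in\mathbb{R}^{3\times3}$, $\mathrm{id}$ is the $3\times 3$ identity matrix, $|\cdot|$ the Euclidean norm, $\times$ the cross product. Define the compact set $$K_{r,s}:=\{z\in Z:\ M=\alpha\otimes\beta+p\,\mathrm{id},\ |\alpha|=r,\ |\beta|=s\}.$$ The wave cone $\Lambda\subset Z$ is the set of all $\bar z=(\bar\alpha,\bar\beta,\bar M)\in Z$ for which there exist $\xi\in\mathbb{R}^3$, $\xi\neq 0$, and $c\in\mathbb{R}$ such that $$\bar M\xi+c\bar\alpha=0,\quad \bar M^T\xi+c\bar\beta=0,\quad \bar\alpha\cdot\xi=0,\quad \bar\beta\cdot\xi=0.$$ A function $f:Z\to\mathbb{R}$ is $\Lambda$-convex if $t\mapsto f(z+t\bar z)$ is convex on $\mathbb{R}$ for every $z\in Z$, $\bar z\in\Lambda$. The $\Lambda$-convex hull $C^\Lambda$ of a compact set $C\subset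 Z$ is the set of points of $Z$ that cannot be separated from $C$ by a $\Lambda$-convex function, i.e. $z\in C^\Lambda$ if and only if $f(z)\le\sup_C f$ for every $\Lambda$-convex $f:Z\to\mathbb{R}$; $K_{r,s}^\Lambda$ denotes the $\Lambda$-convex hull of $K_{r,s}$. For $z=(\alpha,\beta,M)\in Z$ with $|\alpha|\le r$, $|\beta|\le s$, $$M_0(z):=\alpha\otimes\beta-M+p\,\mathrm{id},\qquad G(z):=\sqrt{(r^2-|\alpha|^2)(s^2-|\beta|^2)}.$$ For a skew-symmetric matrix $A\in\mathbb{R}^{3\times3}$, $f_0(A)\in\mathbb{R}^3$ is the unique vector such that $A\xi=\xi\times f_0(A)$ for all $\xi\in\mathbb{R}^3$. The nuclear norm $\|A\|_n$ of a matrix $A$ is the sum of its singular values. *)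

(* Defs.v *)
From HB Require Import structures.
From mathcomp Require Import all_boot all_order all_algebra.
From mathcomp Require Import polyrcf.
From mathcomp Require Import all_classical all_reals all_analysis.
From mathcomp Require Import ring.

Set Implicit Arguments.
Unset Strict Implicit.
Unset Printing Implicit Defensive.

Import Order.TTheory GRing.Theory Num.Theory.
Import numFieldNormedType.Exports.

Local Open Scope classical_set_scope.
Local Open Scope ring_scope.

(* A point z of Z is the triple (alpha, beta, M), with vectors written as
   columns.  The product type carries the product topology, i.e. the usual
   topology of this finite-dimensional space. *)
Notation Zspace R := ('cV[R]_3 * 'cV[R]_3 * 'M[R]_3)%type.

Definition dot (R : realType) (u v : 'cV[R]_3) : R :=
  \sum_(i < 3) u i 0 * v i 0.

(* The library norm [`|u|] on matrices is the sup norm, not the Euclidean one. *)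
Definition enorm (R : realType) (u : 'cV[R]_3) : R := Num.sqrt (dot u u).

Definition outer (R : realType) (u v : 'cV[R]_3) : 'M[R]_3 := u *m v^T.

(* Indices are cyclic modulo 3. *)
Definition cross (R : realType) (u v : 'cV[R]_3) : 'cV[R]_3 :=
  \col_(i < 3) (u (ordS i) 0 * v (ord_pred i) 0 -
                u (ord_pred i) 0 * v (ordS i) 0).

(* The vector f0(A) is defined by its characterization; the value 0 is taken
   when there is no such vector.  For skew-symmetric A the vector exists and is
   unique, see [f0P]. *)
Definition f0 (R : realType) (A : 'M[R]_3) : 'cV[R]_3 :=
  xget 0 [set v | forall xi : 'cV[R]_3, A *m xi = cross xi v].

(* Square roots of the eigenvalues of A^T A (all of which are real and
   nonnegative), repeated according to their multiplicity. *)
Definition singular_values (R : realType) n (A : 'M[R]_n) : seq R :=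
  let chi := char_poly (A^T *m A) in
  flatten [seq nseq (mup x chi) (Num.sqrt x) | x <- rootsR chi].

Definition nuclear_norm (R : realType) n (A : 'M[R]_n) : R :=
  \sum_(x <- singular_values A) x.

Definition Kset (R : realType) (p r s : R) : set (Zspace R) :=
  [set z | let: (alpha, beta, M) := z in
    [/\ M = outer alpha beta + p%:M, enorm alpha = r & enorm beta = s]].

Definition wave_cone (R : realType) : set (Zspace R) :=
  [set z | let: (alpha, beta, M) := z in
    exists xi : 'cV[R]_3, exists c : R,
      [/\ xi != 0, M *m xi + c *: alpha = 0, M^T *m xi + c *: beta = 0,
          dot alpha xi = 0 & dot beta xi = 0]].

Definition Lambda_convex (R : realType) (f : Zspace R -> R) : Prop :=
  forall z zbar : Zspace R, wave_cone zbar ->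
    convex_function (E := R^o) setT (fun t : R => f (z + t *: zbar)).

(* The supremum is taken in the extended reals, because the real-valued [sup]
   of an unbounded or empty set is a junk value. *)
Definition Lambda_hull (R : realType) (C : set (Zspace R)) : set (Zspace R) :=
  [set z | forall f : Zspace R -> R, Lambda_convex f ->
    ((f z)%:E <= ereal_sup [set (f x)%:E | x in C])%E].

Definition M0 (R : realType) (p : R) (z : Zspace R) : 'M[R]_3 :=
  let: (alpha, beta, M) := z in outer alpha beta - M + p%:M.

Definition Gfun (R : realType) (r s : R) (z : Zspace R) : R :=
  let: (alpha, beta, _) := z in
  Num.sqrt ((r ^+ 2 - enorm alpha ^+ 2) * (s ^+ 2 - enorm beta ^+ 2)).

Definition Uset (R : realType) (p r s : R) : set (Zspace R) :=
  [set z | let: (alpha, beta, M) := z in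
    [/\ enorm alpha < r, enorm beta < s,
        dot (f0 (M - M^T)) (alpha - beta) = 0 &
        nuclear_norm (M0 p z) < Gfun r s z]].

Lemma ord3P (P : 'I_3 -> Prop) : P 0 -> P 1 -> P 2%:R -> forall i, P i.
Proof.
move=> P0 P1 P2 [[|[|[|//]]] lti];
  [have -> : Ordinal lti = 0 | have -> : Ordinal lti = 1
  | have -> : Ordinal lti = 2%:R] => //; exact: val_inj.
Qed.

Lemma sum3 (R : realType) (F : 'I_3 -> R) :
  \sum_(i < 3) F i = F 0 + F 1 + F 2%:R.
Proof.
rewrite !big_ord_recr big_ord0 /= add0r.
by do 2?[congr (_ + _)]; congr F; apply: val_inj.
Qed.

Lemma ord3E :
  ((ordS (0 : 'I_3) = 1) * (ordS (1 : 'I_3) = 2%:R) * (ordS (2%:R : 'I_3) = 0) *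
   (ord_pred (0 : 'I_3) = 2%:R) * (ord_pred (1 : 'I_3) = 0) *
   (ord_pred (2%:R : 'I_3) = 1))%type.
Proof. by do !split; apply: val_inj. Qed.

Lemma f0P (R : realType) (A : 'M[R]_3) (v : 'cV[R]_3) : A^T = - A ->
  (forall xi, A *m xi = cross xi v) <-> v = f0 A.
Proof.
move=> skA.
have skE i j : A i j = - A j i by move/matrixP/(_ j i): skA; rewrite !mxE.
have diag0 i : A i i = 0.
  by apply/eqP; rewrite -[_ == 0](mulrn_eq0 _ 2) mulr2n {1}skE addNr.
pose v0 : 'cV[R]_3 := \col_(i < 3) A (ordS i) (ord_pred i).
have uniq w : (forall xi, A *m xi = cross xi w) -> w = v0.
  move=> Hw; apply/colP => i; rewrite mxE.
  have := Hw (delta_mx (ord_pred i) 0) => /colP/(_ (ordS i)).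
  move: i; apply: ord3P; rewrite !mxE sum3 !mxE ?ord3E /=
    ?(mulr0, mulr1, mul0r, addr0, add0r, mul1r, subr0); by move=> ->.
have exv xi : A *m xi = cross xi v0.
  apply/colP; apply: ord3P; rewrite !mxE sum3 ?ord3E diag0.
  - by rewrite (skE 0 2%:R); ring.
  - by rewrite (skE 1 0); ring.
  - by rewrite (skE 2%:R 1); ring.
have f0v : forall xi, A *m xi = cross xi (f0 A).
  by rewrite /f0; case: xgetP => [w _ //|/(_ v0)] []; exact: exv.
by split=> [/uniq ->|-> //]; rewrite (uniq _ f0v).
Qed.

Lemma mup_prod_XsubC (R : realType) (x : R) (s : seq R) :
  mup x (\prod_(y <- s) ('X - y%:P)) = count_mem x s.
Proof.
elim: s => [|y s IH]; first by rewrite big_nil mupNroot // root1.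
rewrite big_cons mupM ?polyXsubC_eq0 ?IH //=; last first.
  by rewrite monic_neq0 // monic_prod_XsubC.
have := mup_XsubCX 1 x y; rewrite expr1 => ->.
by case: (y == x).
Qed.

Lemma nuclear_normE (R : realType) n (A : 'M[R]_n) (s : seq R) :
  all (fun x => 0 <= x) s ->
  char_poly (A^T *m A) = \prod_(x <- s) ('X - (x ^+ 2)%:P) ->
  nuclear_norm A = \sum_(x <- s) x.
Proof.
move=> /allP s_ge0 chiE; pose s2 := [seq x ^+ 2 | x <- s].
have {}chiE : char_poly (A^T *m A) = \prod_(x <- s2) ('X - x%:P).
  by rewrite big_map.
rewrite /nuclear_norm /singular_values chiE big_flatten big_map /=.
have chi0 : \prod_(x <- s2) ('X - x%:P) != 0 :> {poly R}.
  by rewrite monic_neq0 // monic_prod_XsubC.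
have rE : perm_eq (rootsR (\prod_(x <- s2) ('X - x%:P))) (undup s2).
  apply: uniq_perm; [exact: uniq_roots|exact: undup_uniq|] => x.
  have := roots_on_rootsR chi0 x.
  by rewrite mem_undup root_prod_XsubC /= => <-.
rewrite (perm_big _ rE) /=.
under eq_bigr do rewrite big_nseq mup_prod_XsubC -Monoid.iteropE.
rewrite big_undup_iterop_count /= big_map; apply: eq_big_seq => x xs.
by rewrite sqrtr_sqr ger0_norm // s_ge0.
Qed.

(* Main.v *)
Require Import Defs.
From mathcomp Require Import all_boot all_order all_algebra.
From mathcomp Require Import complex.
From mathcomp Require Import all_classical all_reals all_analysis.
From mathcomp Require Import ring lra.

(* The hull is contained in the set where |alpha| <= r, |beta| <= s,
   f0 (M - M^T) . (alpha - beta) = 0 and |M0|_n <= G.  The first two functions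
   are convex.  The third one is a quadratic form that vanishes on the wave cone
   and on K, so both it and its opposite are Lambda-convex.  For the last one,
   |M0|_n = tr (W M0) for some contraction W, and for each t the function
   2 t tr (W M0) + t^2 |alpha|^2 + |beta|^2 is convex with constant value
   t^2 r^2 + s^2 on K; optimizing over t > 0 gives tr (W M0) <= G.
   Finally, (l alpha, l beta, l^2 M + (1 - l^2) p id) tends to z as l tends to 1,
   and for 0 < l < 1 it satisfies the third constraint and the others strictly:
   M0 is multiplied by l^2, and the new G exceeds l^2 G. *)

Set Implicit Arguments.
Unset Strict Implicit.
Unset Printing Implicit Defensive.

Import Order.TTheory GRing.Theory Num.Theory.
Import numFieldNormedType.Exports.

Local Open Scope classical_set_scope.
Local Open Scope ring_scope.

(** * Nuclear norms as traces against contractions *)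

Section ComplexPolar.
Local Open Scope sesquilinear_scope.

Lemma normsq_rowE (C : numClosedFieldType) n (u : 'rV[C]_n) :
  (u *m u^t*) 0 0 = \sum_i `|u 0 i| ^+ 2.
Proof. by rewrite mxE; apply: eq_bigr => i _; rewrite !mxE normCK. Qed.

(* With [A^* A = P^* diag(d) P], [P] unitary, the contraction is
   [P^* diag(d)^(-1/2) P A^*]; the convention [0^-1 = 0] takes care of the
   kernel of [A]. *)
Lemma polar_contraction_complex (C : numClosedFieldType) n (A : 'M[C]_n) :
  exists (s : 'I_n -> C) (W : 'M[C]_n),
    [/\ forall i, 0 <= s i,
        char_poly (A^t* *m A) = \prod_i ('X - (s i ^+ 2)%:P),
        \tr (W *m A) = \sum_i s i &
        forall u : 'rV[C]_n,
          \sum_j `|(u *m W) 0 j| ^+ 2 <= \sum_j `|u 0 j| ^+ 2].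
Proof.
set B := A^t* *m A.
have Bh : B^t* = B by rewrite /B trmx_mul map_mxM trmxCK.
have Bn : B \is normalmx by apply/normalmxP; rewrite Bh.
have /orthomx_spectralP BE := Bn.
have Pu := spectral_unitarymx B.
move: (spectralmx B) (spectral_diag B) BE Pu => P d BE Pu.
rewrite invmx_unitary // in BE.
have PPt : P *m P^t* = 1%:M by apply/unitarymxP.
have PtP : P^t* *m P = 1%:M by apply: mulmx1C.
have PBP : P *m B *m P^t* = diag_mx d.
  by rewrite BE !mulmxA PPt mul1mx -mulmxA PPt mulmx1.
(* Each eigenvalue is the squared Hermitian norm of a row of [P *m A^t*]. *)
have d_ge0 i : 0 <= d 0 i.
  have -> : d 0 i = ((P *m A^t*) *m (P *m A^t*)^t*) i i.
    by rewrite trmx_mul map_mxM trmxCK mulmxA -(mulmxA P) PBP !mxE eqxx mulr1n.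
  rewrite mxE sumr_ge0 // => j _.
  by rewrite [X in _ * X]mxE [X in _ * X^*]mxE mul_conjC_ge0.
pose s i := sqrtC (d 0 i).
pose S : 'M[C]_n := diag_mx (\row_i (s i)^-1).
have s_ge0 i : 0 <= s i by rewrite sqrtC_ge0.
have ssq i : s i ^+ 2 = d 0 i by rewrite sqrtCK.
have Sh : S^t* = S.
  apply/matrixP => i j; rewrite !mxE eq_sym; case: eqP => [->|_].
    by rewrite !mulr1n conj_Creal // ger0_real // invr_ge0.
  by rewrite !mulr0n conjC0.
exists s, (P^t* *m S *m P *m A^t*); split => //.
- rewrite BE /char_poly.
  have -> : char_poly_mx (P^t* *m diag_mx d *m P) =
      map_mx polyC (P^t*) *m char_poly_mx (diag_mx d) *m map_mx polyC P.
    rewrite /char_poly_mx mulmxBr mulmxBl !map_mxM; congr (_ - _).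
    by rewrite -mulmxA -scalar_mxC mulmxA -map_mxM PtP map_mx1 mul1mx.
  rewrite !det_mulmx mulrAC -det_mulmx -map_mxM PtP map_mx1 det1 mul1r.
  rewrite [LHS]char_poly_trig ?diag_mx_is_trig //.
  by apply: eq_bigr => i _; rewrite mxE eqxx mulr1n ssq.
- rewrite -mulmxA -/B BE !mulmxA -(mulmxA _ P) PPt mulmx1 mxtrace_mulC !mulmxA.
  rewrite PPt mul1mx mulmx_diag mxtrace_diag; apply: eq_bigr => i _.
  rewrite !mxE -ssq expr2 mulrA; have [->|s0] := eqVneq (s i) 0.
    by rewrite mulr0.
  by rewrite mulVf // mul1r.
- move=> u; set w := u *m P^t*.
  have -> : \sum_j `|u 0 j| ^+ 2 = \sum_j `|w 0 j| ^+ 2.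
    rewrite -!normsq_rowE /w trmx_mul map_mxM trmxCK.
    by rewrite mulmxA -(mulmxA u) PtP mulmx1.
  rewrite -normsq_rowE.
  (* The matrix [W W^*] is diagonal in the same basis, with entries 1 where [s i] is nonzero and 0
     elsewhere. *)
  have -> : u *m (P^t* *m S *m P *m A^t*) *m (u *m (P^t* *m S *m P *m A^t*))^t* =
      w *m diag_mx (\row_i ((s i)^-1 * d 0 i * (s i)^-1)) *m w^t*.
    rewrite !trmx_mul !map_mxM !trmxCK Sh !mulmxA.
    congr (_ *m _ *m _).
    rewrite -!mulmxA; congr (_ *m (_ *m _)).
    have -> : S *m (P *m (A^t* *m (A *m (P^t* *m S)))) = S *m (P *m B *m P^t*) *m S.
      by rewrite /B !mulmxA.
    rewrite PBP !mulmx_diag; congr diag_mx; apply/rowP => i; rewrite !mxE //.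
  rewrite mxE ler_sum // => i _; rewrite mul_mx_diag !mxE mulrAC -normCK.
  have [->|s0] := eqVneq (s i) 0; first by rewrite invr0 !mulr0 exprn_ge0.
  by rewrite -ssq (_ : _ / _ = 1) ?mulr1 //; field.
Qed.

End ComplexPolar.

(** Euclidean operator norm at most 1, acting on rows and squared to avoid roots. *)
Definition contraction (R : realType) n (W : 'M[R]_n) :=
  forall u : 'rV[R]_n, \sum_j (u *m W) 0 j ^+ 2 <= \sum_j u 0 j ^+ 2.

Local Notation rc := (real_complex _).

(** The real part of the complex contraction works: dropping imaginary parts only shortens the image
    of a real row, and taking real parts commutes with multiplication by the real matrix [A]. *)
Lemma nuclear_norm_contraction (R : realType) n (A : 'M[R]_n) :
  exists2 W : 'M[R]_n, contraction W & nuclear_norm A = \tr (W *m A).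
Proof.
have rcJ x : (rc x)^* = rc x.
  by rewrite conj_Creal //; apply/complex_realP; exists x.
have AJ : map_mx Num.conj (map_mx rc A)^T = map_mx rc A^T.
  by apply/matrixP => i j; rewrite !mxE rcJ.
have [s [W [s_ge0 chiE trE Oc]]] := polar_contraction_complex (map_mx rc A).
pose t i := complex.Re (s i).
have tE i : s i = rc (t i) by rewrite [RHS]RRe_real // ger0_real.
have Re_mulr (z : R[i]) (x : R) : complex.Re (z * rc x) = complex.Re z * x.
  by case: z => a b; simpc.
exists (map_mx (@complex.Re R) W).
- move=> u; have := Oc (map_mx rc u).
  have -> : \sum_j `|map_mx rc u 0 j| ^+ 2 = rc (\sum_j u 0 j ^+ 2).
    rewrite rmorph_sum; apply: eq_bigr => j _.
    by rewrite mxE normCK rcJ expr2 rmorphM.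
  under eq_bigr do rewrite -add_Re2_Im2.
  rewrite -(rmorph_sum (real_complex R)) lecR; apply: le_trans.
  apply: ler_sum => j _; rewrite -[leLHS]addr0 lerD ?sqr_ge0 //.
  suff -> : (u *m map_mx (@complex.Re R) W) 0 j =
    complex.Re ((map_mx rc u *m W) 0 j) by [].
  rewrite !mxE raddf_sum; apply: eq_bigr => k _.
  by rewrite !mxE mulrC -Re_mulr mulrC.
- have -> : \tr (map_mx (@complex.Re R) W *m A) = \sum_i t i.
    have -> : \sum_i t i = complex.Re (\sum_i s i) by rewrite raddf_sum.
    rewrite -trE /mxtrace raddf_sum; apply: eq_bigr => i _.
    rewrite !mxE raddf_sum; apply: eq_bigr => k _.
    by rewrite !mxE -Re_mulr.
  rewrite (@nuclear_normE _ _ _ [seq t i | i <- enum 'I_n]).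
  + by rewrite big_map big_enum.
  + by apply/allP => _ /mapP[i _ ->]; rewrite -lecR -tE.
  + apply: (@map_poly_inj _ _ rc).
    rewrite map_char_poly map_mxM -AJ chiE rmorph_prod big_map big_enum /=.
    by apply: eq_bigr => i _; rewrite tE -(rmorphXn rc) map_polyXsubC.
Qed.

(** Since [v^T W] is no longer than [v], the expression dominates the squared norm of
    [t u + W^T v]. *)
Lemma contraction_bilinear (R : realType) (W : 'M[R]_3) (u v : 'cV[R]_3) (t : R) :
  contraction W ->
  0 <= 2 * t * \tr (W *m outer u v) + t ^+ 2 * dot u u + dot v v.
Proof.
move=> /(_ v^T); set w := v^T *m W => Ow.
have -> : \tr (W *m outer u v) = \sum_i w 0 i * u i 0.
  by rewrite /outer mulmxA mxtrace_mulC mulmxA /mxtrace big_ord1 mxE.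
have vE : \sum_j v^T 0 j ^+ 2 = dot v v.
  by apply: eq_bigr => j _; rewrite mxE expr2.
rewrite vE in Ow; apply: le_trans (lerD (lexx _) Ow).
have -> : 2 * t * (\sum_i w 0 i * u i 0) + t ^+ 2 * dot u u +
    \sum_j w 0 j ^+ 2 = \sum_i (t * u i 0 + w 0 i) ^+ 2.
  by rewrite /dot !sum3; ring.
by rewrite sumr_ge0 // => i _; rewrite sqr_ge0.
Qed.

(** * Coordinates of [f0], and Lambda-convex functions *)

Lemma f0E (R : realType) (A : 'M[R]_3) : A^T = - A ->
  f0 A = \col_i A (ordS i) (ord_pred i).
Proof.
move=> skA; have f0A := (f0P (f0 A) skA).2 erefl.
apply/colP => i; rewrite mxE.
have := f0A (delta_mx (ord_pred i) 0) => /colP/(_ (ordS i)).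
move: i; apply: ord3P; rewrite !mxE sum3 !mxE ?ord3E /=
  ?(mulr0, mulr1, mul0r, addr0, add0r, mul1r, subr0); by move=> ->.
Qed.

Lemma Lambda_convex_quadratic (R : realType) (f : Zspace R -> R) :
  (forall z zbar, wave_cone zbar -> exists a b c, 0 <= c /\
     forall t, f (z + t *: zbar) = a + t * b + t ^+ 2 * c) ->
  Lambda_convex f.
Proof.
move=> fE z zbar /(fE z)[a [b [c [c_ge0 {}fE]]]] t x y _ _.
rewrite !fE !convRE (_ : conv t x y = t%:inum * x + (1 - t%:inum) * y) //.
have [k0 k1] : 0 <= t%:inum /\ 0 <= 1 - t%:inum :> R
  by rewrite subr_ge0 ge0 le1.
rewrite /=; move: (t%:inum) k0 k1 => k k0 k1.
(* The convexity defect of a quadratic polynomial is its leading coefficient times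
   [k * (1 - k) * (x - y) ^+ 2]. *)
have -> : k * (a + x * b + x ^+ 2 * c) + (1 - k) * (a + y * b + y ^+ 2 * c) =
    a + (k * x + (1 - k) * y) * b + (k * x + (1 - k) * y) ^+ 2 * c +
    k * (1 - k) * (x - y) ^+ 2 * c by ring.
rewrite lerDl; apply: mulr_ge0 => //.
by apply: mulr_ge0; [exact: mulr_ge0|exact: (@sqr_ge0 R)].
Qed.

Lemma Lambda_hull_le (R : realType) (C : set (Zspace R)) f (b : R) z :
  Lambda_convex f -> (forall x, C x -> f x <= b) -> Lambda_hull C z -> f z <= b.
Proof.
move=> fc fb /(_ f fc) /le_trans => /(_ b%:E); rewrite lee_fin; apply.
by apply: ub_ereal_sup => _ [x Cx <-]; rewrite lee_fin fb.
Qed.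

Lemma Lambda_convex_norm_l (R : realType) :
  Lambda_convex (fun z : Zspace R => dot z.1.1 z.1.1).
Proof.
apply: Lambda_convex_quadratic => -[[a b] M] [[a' b'] M'] _.
exists (dot a a), (2 * dot a a'), (dot a' a'); split=> [|t].
  by rewrite sumr_ge0 // => i _; rewrite -expr2 sqr_ge0.
by rewrite /dot !sum3 /= !mxE; ring.
Qed.

Lemma Lambda_convex_norm_r (R : realType) :
  Lambda_convex (fun z : Zspace R => dot z.1.2 z.1.2).
Proof.
apply: Lambda_convex_quadratic => -[[a b] M] [[a' b'] M'] _.
exists (dot b b), (2 * dot b b'), (dot b' b'); split=> [|t].
  by rewrite sumr_ge0 // => i _; rewrite -expr2 sqr_ge0.
by rewrite /dot !sum3 /= !mxE; ring.
Qed.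

(* The quadratic part is nonnegative because [tr (W (alpha (x) beta))] is at most
   [|alpha| |beta|] in absolute value, so this function is even convex. *)
Lemma Lambda_convex_trace (R : realType) (p t : R) (W : 'M[R]_3) :
  contraction W ->
  Lambda_convex (fun z : Zspace R =>
    2 * t * \tr (W *m M0 p z) + t ^+ 2 * dot z.1.1 z.1.1 + dot z.1.2 z.1.2).
Proof.
move=> Wc; apply: Lambda_convex_quadratic => -[[a b] M] [[a' b'] M'] _.
exists (2 * t * \tr (W *m M0 p (a, b, M)) + t ^+ 2 * dot a a + dot b b),
  (2 * t * (\tr (W *m (outer a b' + outer a' b - M'))) +
   2 * t ^+ 2 * dot a a' + 2 * dot b b'),
  (2 * t * \tr (W *m outer a' b') + t ^+ 2 * dot a' a' + dot b' b').
split=> [|x]; first exact: contraction_bilinear.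
have dotD (u v : 'cV[R]_3) : dot (u + x *: v) (u + x *: v) =
    dot u u + x * (2 * dot u v) + x ^+ 2 * dot v v.
  by rewrite /dot !sum3 !mxE; ring.
have -> : M0 p ((a, b, M) + x *: (a', b', M')) =
    M0 p (a, b, M) + x *: (outer a b' + outer a' b - M') +
    x ^+ 2 *: outer a' b'.
  rewrite /M0 /= /outer linearD /= linearZ /= mulmxDl !mulmxDr -!scalemxAl.
  rewrite -!scalemxAr; apply/matrixP => i j; rewrite !mxE; ring.
rewrite /= !dotD !mulmxDr !linearD /= -!scalemxAr !linearZ /=; ring.
Qed.

Definition skew_form (R : realType) (z : Zspace R) : R :=
  let: (alpha, beta, M) := z in dot (f0 (M - M^T)) (alpha - beta).

Lemma skew_formE (R : realType) (a b : 'cV[R]_3) (M : 'M[R]_3) :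
  skew_form (a, b, M) =
    (M 1 2%:R - M 2%:R 1) * (a 0 0 - b 0 0) +
    (M 2%:R 0 - M 0 2%:R) * (a 1 0 - b 1 0) +
    (M 0 1 - M 1 0) * (a 2%:R 0 - b 2%:R 0).
Proof.
rewrite /skew_form f0E; first by rewrite /dot sum3 !mxE !ord3E.
by apply/matrixP => i j; rewrite !mxE opprB.
Qed.

(* If [c = 0] then [v] is parallel to [xi], hence orthogonal to [w]; otherwise
   [c w] is orthogonal to [v] as a cross product. *)
Lemma cross_orthogonal (R : realType) (xi v w : 'cV[R]_3) (c : R) :
  xi != 0 -> cross xi v + c *: w = 0 -> dot w xi = 0 -> dot v w = 0.
Proof.
move=> xi_neq0 vw0 wxi.
have xi2 : dot xi xi != 0.
  apply: contra xi_neq0 => /eqP xi0; apply/eqP/colP => i; rewrite !mxE.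
  apply/eqP; rewrite -sqrf_eq0 expr2.
  move/eqP: xi0; rewrite psumr_eq0 => [/allP/(_ i (mem_index_enum i))//|j _].
  by rewrite -expr2 sqr_ge0.
have cwE i : c * w i 0 = xi (ord_pred i) 0 * v (ordS i) 0 -
                         xi (ordS i) 0 * v (ord_pred i) 0.
  by move/colP/(_ i)/eqP: vw0; rewrite !mxE addrC addr_eq0 opprB => /eqP.
have [c0|c_neq0] := eqVneq c 0; last first.
  apply: (mulfI c_neq0); rewrite mulr0 /dot sum3 !mulrDr.
  rewrite ![c * (v _ _ * _)]mulrCA !cwE !ord3E; ring.
have := (cwE 0, cwE 1, cwE 2%:R); rewrite c0 !mul0r !ord3E.
move=> [[/esym e0 /esym e1] /esym e2].
apply: (mulfI xi2); rewrite mulr0; move: wxi; rewrite /dot !sum3 => wxi.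
(* Binet-Cauchy: [|xi|^2 (v . w)] equals [(w . xi) (xi . v) + (xi x v) . (xi x w)]. Here [w . xi]
   and [xi x v] both vanish. *)
rewrite -[RHS](_ : (w 0 0 * xi 0 0 + w 1 0 * xi 1 0 + w 2%:R 0 * xi 2%:R 0) *
    (xi 0 0 * v 0 0 + xi 1 0 * v 1 0 + xi 2%:R 0 * v 2%:R 0) +
  (xi 2%:R 0 * v 1 0 - xi 1 0 * v 2%:R 0) *
    (xi 2%:R 0 * w 1 0 - xi 1 0 * w 2%:R 0) +
  (xi 0 0 * v 2%:R 0 - xi 2%:R 0 * v 0 0) *
    (xi 0 0 * w 2%:R 0 - xi 2%:R 0 * w 0 0) +
  (xi 1 0 * v 0 0 - xi 0 0 * v 1 0) *
    (xi 1 0 * w 0 0 - xi 0 0 * w 1 0) = 0); first ring.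
by rewrite wxi e0 e1 e2 !mul0r !addr0.
Qed.

(** Subtracting the two matrix equations of the cone gives [xi x f0 (M - M^T) + c (a - b) = 0], and
    [a - b] is orthogonal to [xi]. *)
Lemma skew_form_wave_cone (R : realType) (z : Zspace R) :
  wave_cone z -> skew_form z = 0.
Proof.
case: z => -[a b] M [xi] [c] [xi_neq0 Mxi Mtxi axi bxi].
have skA : (M - M^T)^T = - (M - M^T).
  by apply/matrixP => i j; rewrite !mxE opprB.
apply: (cross_orthogonal xi_neq0 (c := c)).
  rewrite -((f0P _ skA).2 erefl) mulmxBl scalerBr addrACA Mxi -opprD Mtxi.
  by rewrite oppr0 addr0.
by move: axi bxi; rewrite /dot !sum3 !mxE => e1 e2; lra.
Qed.

Lemma Lambda_convex_skew_form (R : realType) (k : R) :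
  Lambda_convex (fun z => k * skew_form z).
Proof.
apply: Lambda_convex_quadratic => -[[a b] M] [[a' b'] M'] /skew_form_wave_cone z0.
(* The increment at [t = 1] is the bilinear term plus the form at the direction, whence the factor
   [t ^+ 2 - t] below. *)
pose B := skew_form (a + a', b + b', M + M') - skew_form (a, b, M).
exists (k * skew_form (a, b, M)), (k * B), 0; split=> // t.
have -> : skew_form ((a, b, M) + t *: (a', b', M')) =
    skew_form (a, b, M) + t * B + (t ^+ 2 - t) * skew_form (a', b', M').
  rewrite (_ : _ + t *: _ = (a + t *: a', b + t *: b', M + t *: M')) //.
  by rewrite /B !skew_formE !mxE; ring.
by rewrite z0; ring.
Qed.

(** * Constraints inherited by the hull of K *)

Lemma enorm_sqr (R : realType) (u : 'cV[R]_3) : enorm u ^+ 2 = dot u u.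
Proof.
by rewrite sqr_sqrtr // sumr_ge0 // => i _; rewrite -expr2 sqr_ge0.
Qed.

Lemma Lambda_hull_Kset_norms (R : realType) (r s p : R) a b M :
  Lambda_hull (Kset p r s) (a, b, M) -> dot a a <= r ^+ 2 /\ dot b b <= s ^+ 2.
Proof.
move=> zK; split.
- apply: (Lambda_hull_le (@Lambda_convex_norm_l R) _ zK) => -[[a' b'] M'] [_ <- _].
  by rewrite enorm_sqr.
- apply: (Lambda_hull_le (@Lambda_convex_norm_r R) _ zK) => -[[a' b'] M'] [_ _ <-].
  by rewrite enorm_sqr.
Qed.

(** On K the vector [f0 (M - M^T)] is the cross product of alpha and beta, orthogonal to both. The
    factors 1 and -1 turn the hull inequality into an equality. *)
Lemma Lambda_hull_Kset_skew_form (R : realType) (r s p : R) z :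
  Lambda_hull (Kset p r s) z -> skew_form z = 0.
Proof.
have K0 x : Kset p r s x -> skew_form x = 0.
  by case: x => -[a b] M [-> _ _]; rewrite skew_formE !mxE !big_ord1 !mxE /=; ring.
have le0 k : Lambda_hull (Kset p r s) z -> k * skew_form z <= 0.
  apply: (Lambda_hull_le (Lambda_convex_skew_form k)) => x /K0 ->.
  by rewrite mulr0.
move=> zK; have := le0 1 zK; have := le0 (-1) zK; lra.
Qed.

Lemma Lambda_hull_Kset_trace (R : realType) (r s p : R) z (W : 'M[R]_3) :
  contraction W -> Lambda_hull (Kset p r s) z -> \tr (W *m M0 p z) <= Gfun r s z.
Proof.
case: z => -[a b] M Wc zK; have [ar bs] := Lambda_hull_Kset_norms zK.
set N := \tr _; rewrite /Gfun !enorm_sqr.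
have x_ge0 : 0 <= r ^+ 2 - dot a a by rewrite subr_ge0.
have y_ge0 : 0 <= s ^+ 2 - dot b b by rewrite subr_ge0.
have NE t : 2 * t * N <= t ^+ 2 * (r ^+ 2 - dot a a) + (s ^+ 2 - dot b b).
  have := Lambda_hull_le (Lambda_convex_trace p t Wc)
    (b := t ^+ 2 * r ^+ 2 + s ^+ 2) _ zK; rewrite /= -/N => H.
  suff /H : forall x : Zspace R, Kset p r s x -> 2 * t * \tr (W *m M0 p x) +
      t ^+ 2 * dot x.1.1 x.1.1 + dot x.1.2 x.1.2 <= t ^+ 2 * r ^+ 2 + s ^+ 2.
    by lra.
  move=> [[a' b'] M'] [-> <- <-] /=; rewrite !enorm_sqr opprD addrA subrr.
  by rewrite sub0r addNr mulmx0 mxtrace0 mulr0 add0r.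
move: x_ge0 y_ge0 NE; set x := _ - _; set y := _ - _ => x_ge0 y_ge0 NE.
have [N_le0|N_gt0] := leP N 0; first exact: le_trans N_le0 (sqrtr_ge0 _).
rewrite -(ger0_norm (ltW N_gt0)) -sqrtr_sqr ler_sqrt ?mulr_ge0 //.
have [x0|x_neq0] := eqVneq x 0.
  (* With [x = 0] the bound reads [2 * t * N <= y] for every [t]; this [t] makes the left side
     [y + 1]. *)
  have := NE ((y + 1) / (2 * N)); rewrite x0 mulr0 add0r.
  have -> : 2 * ((y + 1) / (2 * N)) * N = y + 1 by field; rewrite gt_eqF.
  by rewrite gerDl ler10.
have x_gt0 : 0 < x by rewrite lt_neqAle eq_sym x_neq0.
(* The minimizer of [t ^+ 2 * x - 2 * t * N]; it yields [N ^+ 2 <= x * y]. *)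
have := NE (N / x); rewrite -(ler_pM2l x_gt0).
have -> : x * (2 * (N / x) * N) = 2 * N ^+ 2 by field.
have -> : x * ((N / x) ^+ 2 * x + y) = N ^+ 2 + x * y by field.
by lra.
Qed.

(** * Pushing the hull into U by contraction *)

(* The multiple of the identity is chosen so that [M0 p] scales by [l ^+ 2]. *)
Definition contract (R : realType) (p : R) (z : Zspace R) (l : R) : Zspace R :=
  let: (alpha, beta, M) := z in
  (l *: alpha, l *: beta, l ^+ 2 *: M + ((1 - l ^+ 2) * p)%:M).

Lemma contract_cvg (R : realType) (p : R) (z : Zspace R) :
  contract p z l @[l --> 1^'-] --> z.
Proof.
case: z => -[a b] M; rewrite /contract.
have l_cvg : l @[l --> (1 : R)^'-] --> (1 : R) by exact: cvg_at_left_filter.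
have l2_cvg : l ^+ 2 @[l --> (1 : R)^'-] --> (1 : R).
  suff : l ^+ 2 @[l --> (1 : R)^'-] --> (1 * 1 : R) by rewrite mulr1.
  exact: cvgM.
have lZ_cvg m n (u : R -> R) (A : 'M[R]_(m.+1, n.+1)) :
    u l @[l --> (1 : R)^'-] --> (1 : R) -> u l *: A @[l --> (1 : R)^'-] --> A.
  move=> u_cvg.
  suff : u l *: A @[l --> (1 : R)^'-] --> 1 *: A by rewrite scale1r.
  exact: cvgZr_tmp.
apply: (@cvg_pair _ _ _ _ (nbhs (a, b)) (nbhs M)).
  by apply: (@cvg_pair _ _ _ _ (nbhs a) (nbhs b)); exact: lZ_cvg.
suff : l ^+ 2 *: M + ((1 - l ^+ 2) * p) *: 1%:M @[l --> (1 : R)^'-] -->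
    M + ((1 - 1) * p) *: (1%:M : 'M[R]_3).
  rewrite subrr mul0r scale0r addr0.
  by under eq_fun do rewrite scalemx1.
apply: cvgD; first exact: lZ_cvg.
apply: cvgZr_tmp; apply: cvgMr_tmp; apply: cvgB => //; exact: cvg_cst.
Qed.

Lemma contract_Uset (R : realType) (r s p l : R) z : 0 < r -> 0 < s ->
  Lambda_hull (Kset p r s) z -> 0 < l < 1 -> Uset p r s (contract p z l).
Proof.
move=> r_gt0 s_gt0 zK /andP[l_gt0 l_lt1].
(* [W] is adapted to the contracted point, but the trace bound at [z] holds for every contraction,
   hence for this one. *)
have [W Wc nE] := nuclear_norm_contraction (M0 p (contract p z l)).
have := Lambda_hull_Kset_trace Wc zK; have := Lambda_hull_Kset_skew_form zK.
case: z zK nE => -[a b] M zK nE z0 Nle; have [ar bs] := Lambda_hull_Kset_norms zK.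
have dotZ (u : 'cV[R]_3) : dot (l *: u) (l *: u) = l ^+ 2 * dot u u.
  by rewrite /dot !sum3 !mxE; ring.
have l2_lt1 : l ^+ 2 < 1 by rewrite expr_lt1 // ltW.
have l2_gt0 : 0 < l ^+ 2 by rewrite exprn_gt0.
have dot_ge0 (u : 'cV[R]_3) : 0 <= dot u u by rewrite -enorm_sqr sqr_ge0.
have enorm_lt (u : 'cV[R]_3) q : 0 < q -> dot u u <= q ^+ 2 -> enorm (l *: u) < q.
  move=> q_gt0 uq; rewrite -[q]ger0_norm ?ltW // -sqrtr_sqr ltr_sqrt ?exprn_gt0 //.
  by rewrite dotZ; have := exprn_gt0 2 q_gt0; nra.
split; [exact: enorm_lt | exact: enorm_lt | |].
- rewrite -[LHS]/(skew_form (contract p (a, b, M) l)).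
  (* The skew part of [M] scales by [l ^+ 2] and [alpha - beta] by [l]; the added scalar matrix is
     symmetric. *)
  rewrite -[RHS](mulr0 (l ^+ 3)) -z0 !skew_formE !mxE /=; ring.
- rewrite nE.
  have -> : M0 p (contract p (a, b, M) l) = l ^+ 2 *: M0 p (a, b, M).
    rewrite /M0 /= /outer; apply/matrixP => i j; rewrite !mxE !big_ord1 !mxE.
    by case: (i == j) => /=; ring.
  rewrite -scalemxAr linearZ /=.
  apply: le_lt_trans (ler_wpM2l (ltW l2_gt0) Nle) _.
  rewrite /Gfun !enorm_sqr !dotZ -[l ^+ 2 in ltLHS]ger0_norm ?ltW // -sqrtr_sqr.
  rewrite -sqrtrM ?sqr_ge0 //.
  have r2 := exprn_gt0 2 r_gt0; have s2 := exprn_gt0 2 s_gt0.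
  move: (dot a a) (dot b b) (r ^+ 2) (s ^+ 2) (l ^+ 2) ar bs r2 s2 l2_lt1 l2_gt0.
  move=> x y A B m xA yB A0 B0 m1 m0.
  (* With [m = l ^+ 2], the gap between the squares of the two bounds is a sum of nonnegative terms,
     the first strictly positive because [r], [s] are positive and [m < 1]. *)
  have e : (A - m * x) * (B - m * y) - m ^+ 2 * ((A - x) * (B - y)) =
     (1 - m) ^+ 2 * (A * B) + m * (1 - m) * (A * (B - y)) +
     m * (1 - m) * ((A - x) * B) by ring.
  have lt : m ^+ 2 * ((A - x) * (B - y)) < (A - m * x) * (B - m * y).
    rewrite -subr_gt0 e; apply: ltr_pwDl; first apply: ltr_pwDl.
    + by rewrite !mulr_gt0 ?subr_gt0.
    + by rewrite !mulr_ge0 ?subr_ge0 // ltW.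
    + by rewrite !mulr_ge0 ?subr_ge0 // ltW.
  rewrite ltr_sqrt //; apply: le_lt_trans lt.
  by rewrite !mulr_ge0 ?subr_ge0 // ltW.
Qed.

Theorem proposition2p5 (R : realType) (r s p : R)
    (r_gt0 : 0 < r) (s_gt0 : 0 < s) (p_le : `|p| <= r * s) :
  Lambda_hull (Kset p r s) `<=` closure (Uset p r s).
Proof.
move=> z zK.
apply: (closed_cvg _ (@closed_closure _ _) _ _ (@contract_cvg R p z)).
near=> l; apply: subset_closure; apply: contract_Uset => //.
by apply/andP; split; near: l; [exact: nbhs_left_gt | exact: nbhs_left_lt].
Unshelve. all: by end_near.
Qed.
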